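(* Let $G_1=(V_1,E_1)$ and $G_2=(V_2,E_2)$ be graphs on disjoint vertex sets, let $U_1\subseteq V_1$ and $U_2\subseteq V_2$ be non-empty, and let $G=G_1\oplus_{U_1,U_2}G_2$ be linked with covers; set $p_1=\prod_{x\in U_1}x$ and $p_2=\prod_{y\in U_2}y$. Let $I$ be the cover ideal of $G$ and let $I_i$ be the cover ideal of $G_i$ for $i=1,2$. Assume that $p_1,p_2$ are either both minimal 1-covers (of $G_1$ and $G_2$ respectively) or both non-minimal. The following conditions are equivalent: (1) $I$ is quasi-equigenerated. (2) Both $I_1$ and $I_2$ are quasi-equigenerated.
   Context: All graphs are finite and simple; vertices are identified with variables of a polynomial ring over a field $k$. The graph $G_1\oplus_{U_1,U_2}G_2$ has vertex set $V_1\cup V_2$ and edge set $E_1\cup E_2\cup\{\{x,y\}: x\in U_1,\ y\in U_2\}$. A 1-cover of a graph is a monomial in its vertices such that every edge has at least one endpoint dividing the monomial; it is minimal if it is not divisible by any other 1-cover. $G_1\oplus_{U_1,U_2}G_2$ is called linked with covers if $p_1=\prod_{x\in U_1}x$ is a 1-cover of $G_1$ and $p_2=\prod_{y\in U_2}y$ is a 1-cover of $G_2$ (not necessarily minimal). For a graph $G$ with vertices $x_1,\dots,x_n$ and edge set $E$, the cover ideal is $J(G)=\bigcap_{\{x_i,x_j\}\in E}(x_i,x_j)\subseteq k[x_1,\dots,x_n]$; its minimal monomial generators are the minimal 1-covers. A monomial ideal $I$ with minimal monomial generators $f_1,\dots,f_t$, $f_j=\prod_{i=1}^n x_i^{c_{ij}}$,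 is quasi-equigenerated if there is $\alpha=(a_1,\dots,a_n)$ with all $a_i$ positive integers such that $d_\alpha(f_j):=\sum_{i=1}^n a_i c_{ij}$ is the same for all $j$. *)

(* Defs.v *)
From HB Require Import structures.
From mathcomp Require Import all_boot all_order all_algebra.
From mathcomp Require Import finmap.
From mathcomp.multinomials Require Import monalg.

Set Implicit Arguments.
Unset Strict Implicit.
Unset Printing Implicit Defensive.

Import GRing.Theory.
Local Open Scope ring_scope.

Record graph (V : finType) := Graph {
  edge :> rel V;
  edge_sym : symmetric edge;
  edge_irr : irreflexive edge
}.

(* Disjointness of the two vertex sets is built in: the vertex set of the
   join is the disjoint sum V1 + V2. *)
Definition join_rel (V1 V2 : finType) (G1 : graph V1) (G2 : graph V2)
    (U1 : {set V1}) (U2 : {set V2}) : rel (V1 + V2)%type :=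
  fun u v => match u, v with
  | inl x, inl x' => edge G1 x x'
  | inr y, inr y' => edge G2 y y'
  | inl x, inr y | inr y, inl x => (x \in U1) && (y \in U2)
  end.

Lemma join_rel_sym (V1 V2 : finType) (G1 : graph V1) (G2 : graph V2)
    (U1 : {set V1}) (U2 : {set V2}) : symmetric (join_rel G1 G2 U1 U2).
Proof. by case=> [x|y] [x'|y'] //=; rewrite edge_sym. Qed.

Lemma join_rel_irr (V1 V2 : finType) (G1 : graph V1) (G2 : graph V2)
    (U1 : {set V1}) (U2 : {set V2}) : irreflexive (join_rel G1 G2 U1 U2).
Proof. by case=> [x|y] /=; rewrite edge_irr. Qed.

Definition graph_join (V1 V2 : finType) (G1 : graph V1) (G2 : graph V2)
    (U1 : {set V1}) (U2 : {set V2}) : graph (V1 + V2)%type :=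
  Graph (join_rel_sym G1 G2 U1 U2) (join_rel_irr G1 G2 U1 U2).

(* Monomials in the vertices of V are elements of {cmonom V}; the polynomial
   ring over k with one variable per vertex is {malg k[{cmonom V}]}, in which
   << m >> is the monomial m and << ucm x >> is the variable x. *)

Definition mdivides (V : finType) (m m' : {cmonom V}) : Prop :=
  exists q : {cmonom V}, m' = mmul q m.

Definition vprod (V : finType) (U : {set V}) : {cmonom V} :=
  \big[@mmul {cmonom V}/@mone {cmonom V}]_(x in U) ucm x.

Definition is_cover (V : finType) (G : graph V) (m : {cmonom V}) : Prop :=
  forall x y : V, edge G x y -> mdivides (ucm x) m \/ mdivides (ucm y) m.

Definition minimal_cover (V : finType) (G : graph V) (m : {cmonom V}) : Prop :=
  is_cover G m /\
  forall m' : {cmonom V}, is_cover G m' -> mdivides m' m -> m' = m.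

Definition linked_with_covers (V1 V2 : finType) (G1 : graph V1)
    (G2 : graph V2) (U1 : {set V1}) (U2 : {set V2}) : Prop :=
  is_cover G1 (vprod U1) /\ is_cover G2 (vprod U2).

(* Ideals are represented by their membership predicates: the ideal structures
   of ring_quotient are boolean and exclude the unit ideal, which is the cover
   ideal of an edgeless graph. *)

Definition ideal_gen (R : comNzRingType) (gs : seq R) (p : R) : Prop :=
  exists c : nat -> R, p = \sum_(i < size gs) c i * gs`_i.

Definition cover_ideal (k : fieldType) (V : finType) (G : graph V)
    (p : {malg k[{cmonom V}]}) : Prop :=
  forall x y : V, edge G x y -> ideal_gen [:: << ucm x >>; << ucm y >>] p.

Definition generated_by (k : fieldType) (V : finType)
    (I : {malg k[{cmonom V}]} -> Prop) (fs : seq {cmonom V}) : Prop :=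
  forall p, I p <-> ideal_gen [seq << f >> | f <- fs] p.

Definition minimal_monomial_generators (k : fieldType) (V : finType)
    (I : {malg k[{cmonom V}]} -> Prop) (fs : seq {cmonom V}) : Prop :=
  [/\ uniq fs,
      generated_by I fs &
      forall gs : seq {cmonom V},
        {subset gs <= fs} -> generated_by I gs -> {subset fs <= gs}].

Definition wdeg (V : finType) (alpha : V -> nat) (m : {cmonom V}) : nat :=
  (\sum_(x : V) alpha x * m x)%N.

Definition quasi_equigenerated (k : fieldType) (V : finType)
    (I : {malg k[{cmonom V}]} -> Prop) : Prop :=
  exists fs : seq {cmonom V},
    minimal_monomial_generators I fs /\
    exists alpha : V -> nat,
      (forall x, (0 < alpha x)%N) /\
      {in fs &, forall f g, wdeg alpha f = wdeg alpha g}.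

(* Main.v *)
Require Import Defs.
From mathcomp Require Import all_boot all_order all_algebra.
From mathcomp Require Import finmap ring.
From mathcomp.multinomials Require Import monalg.

(** The minimal generators of a cover ideal are the minimal vertex covers, so
quasi-equigeneration of [J(G)] asks for a positive weight on vertices giving all
minimal vertex covers the same total weight.  Under the hypotheses, the minimal
vertex covers of the join are the [U1 + B] and [A + U2] with [A], [B] minimal
covers of [G1], [G2]: a minimal cover containing [U1] contains no other vertex
of [G1], and removing a vertex of [U1] from [U1 + B] forces [U2] into [B], so
that [B = U2] is minimal and hence so is [U1].  A weight on the join thus
restricts to [G1] and [G2].  Conversely, given weights with common values [d1]
and [d2], the excesses [e_i = w_i(U_i) - d_i] are both zero or both positive; in
the latter case [e2 w1] and [e1 w2] glue to a weight with the same value on all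
minimal covers of the join. *)

Set Implicit Arguments.
Unset Strict Implicit.
Unset Printing Implicit Defensive.

Import GRing.Theory.
Local Open Scope ring_scope.

(** * Divisibility and squarefree monomials *)

Lemma mdividesP (V : finType) (m m' : {cmonom V}) :
  mdivides m m' <-> forall x, (m x <= m' x)%N.
Proof.
split=> [[q ->] x|le_mm']; first by rewrite cmM leq_addl.
by exists (divcm m' m); apply/eqP/cmP=> x; rewrite cmM divcmE subnK.
Qed.

Lemma mdivides_trans (V : finType) (m1 m2 m3 : {cmonom V}) :
  mdivides m1 m2 -> mdivides m2 m3 -> mdivides m1 m3.
Proof.
move=> /mdividesP le12 /mdividesP le23; apply/mdividesP=> x.
exact: leq_trans (le12 x) (le23 x).
Qed.

Lemma vprodE (V : finType) (U : {set V}) (x : V) : vprod U x = (x \in U) :> nat.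
Proof.
(* Reading off the exponent of [x] turns the product into a sum over [U], in which only the variable
   [x] itself contributes. *)
rewrite /vprod (big_morph (fun m : {cmonom V} => m x) (fun m m' => cmM x m m')
                 (cm1 x)).
case: (boolP (x \in U)) => [xU|xU]; last first.
  by rewrite big1 // => y yU; rewrite cmU; case: eqP xU => // <-; rewrite yU.
rewrite (bigD1 x) //= cmUU big1 // => y /andP[_ /negbTE].
by rewrite cmU => ->.
Qed.

Lemma wdeg_vprod (V : finType) (alpha : V -> nat) (U : {set V}) :
  wdeg alpha (vprod U) = \sum_(x in U) alpha x.
Proof.
rewrite /wdeg [RHS]big_mkcond /=; apply: eq_bigr => x _.
by rewrite vprodE; case: (x \in U); rewrite ?muln1 ?muln0.
Qed.

(** * Membership in monomial ideals *)

Lemma mem_ideal_gen (R : comNzRingType) (gs : seq R) (a g : R) :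
  g \in gs -> ideal_gen gs (a * g).
Proof.
move=> ggs; exists (fun i => if i == index g gs then a else 0).
have lt_g : (index g gs < size gs)%N by rewrite index_mem.
rewrite (bigD1 (Ordinal lt_g)) //= eqxx nth_index // big1 ?addr0 // => i.
by rewrite -val_eqE /= => /negbTE ->; rewrite mul0r.
Qed.

Lemma ideal_gen0 (R : comNzRingType) (gs : seq R) : ideal_gen gs 0.
Proof. by exists (fun=> 0); rewrite big1 // => i _; rewrite mul0r. Qed.

Lemma ideal_genD (R : comNzRingType) (gs : seq R) (p q : R) :
  ideal_gen gs p -> ideal_gen gs q -> ideal_gen gs (p + q).
Proof.
move=> [c ->] [d ->]; exists (fun i => c i + d i).
by rewrite -big_split; apply: eq_bigr => i _; rewrite mulrDl.
Qed.

(** A monomial in the support of a combination of generators survives in some summand [c i * f], so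
    [f] divides it. Conversely, [p] is the sum of its terms, each a multiple of a generator. *)
Lemma monomial_ideal_genP (k : fieldType) (V : finType) (fs : seq {cmonom V})
    (p : {malg k[{cmonom V}]}) :
  ideal_gen [seq << f >> | f <- fs] p <->
  forall m, m \in msupp p -> exists2 f, f \in fs & mdivides f m.
Proof.
split=> [[c ->] m|div_p].
  rewrite -mcoeff_neq0 raddf_sum /=.
  set gs := [seq _ | _ <- _] => nz.
  have [i nzi] : exists i : 'I_(size gs), (c i * gs`_i)@_m != 0.
    apply/existsP; apply: contraNT nz; rewrite negb_exists => /forallP z.
    by rewrite big1 // => i _; apply/eqP; rewrite -[_ == _]negbK z.
  have lti : (i < size fs)%N.
    by apply: leq_trans (ltn_ord i) _; rewrite size_map.
  move: nzi; rewrite (nth_map mone) // mcoeff_neq0.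
  case/msuppM_le => q [f [_]]; rewrite msuppU1 in_fset1 => /eqP -> ->.
  by exists (nth mone fs i); [exact: mem_nth | exists q].
rewrite (monalgE p) big_seq; apply: (big_ind (ideal_gen _)).
- exact: ideal_gen0.
- exact: ideal_genD.
move=> m /div_p[f ffs [q ->]].
have -> : << p@_(mmul q f) *g mmul q f >> = << p@_(mmul q f) *g q >> * << f >>
    :> {malg k[{cmonom V}]}.
  by rewrite malgM_def fgmulUU mulr1.
by apply/mem_ideal_gen/map_f.
Qed.

(** * Vertex covers as a boolean predicate on sets, to which [minset] applies *)

Definition vertex_cover (V : finType) (G : graph V) (S : {set V}) : bool :=
  [forall x, forall y, edge G x y ==> (x \in S) || (y \in S)].

Lemma vertex_coverP (V : finType) (G : graph V) (S : {set V}) :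
  reflect (forall x y, edge G x y -> (x \in S) || (y \in S)) (vertex_cover G S).
Proof.
apply: (iffP forallP) => [cov x y|cov x].
  by move/forallP: (cov x) => /(_ y)/implyP.
by apply/forallP=> y; apply/implyP/cov.
Qed.

Lemma vertex_coverS (V : finType) (G : graph V) (S T : {set V}) :
  S \subset T -> vertex_cover G S -> vertex_cover G T.
Proof.
move=> /subsetP sST /vertex_coverP cov; apply/vertex_coverP=> x y /cov.
by case/orP=> /sST ->; rewrite ?orbT.
Qed.

Lemma mdivides_ucm (V : finType) (x : V) (m : {cmonom V}) :
  mdivides (ucm x) m <-> (0 < m x)%N.
Proof.
rewrite mdividesP; split=> [/(_ x)|m_x y]; first by rewrite cmUU.
by rewrite cmU; case: eqP => // <-.
Qed.

Lemma is_coverE (V : finType) (G : graph V) (m : {cmonom V}) :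
  is_cover G m <-> vertex_cover G [set x | 0 < m x]%N.
Proof.
split=> [cov|/vertex_coverP cov x y /cov].
  apply/vertex_coverP=> x y /cov; rewrite !inE.
  by case=> /mdivides_ucm ->; rewrite ?orbT.
by rewrite !inE => /orP[]/mdivides_ucm; [left|right].
Qed.

Lemma vprod_supp (V : finType) (S : {set V}) : [set x | 0 < vprod S x]%N = S.
Proof. by apply/setP=> x; rewrite inE vprodE lt0b. Qed.

Lemma is_cover_vprod (V : finType) (G : graph V) (S : {set V}) :
  is_cover G (vprod S) <-> vertex_cover G S.
Proof. by rewrite is_coverE vprod_supp. Qed.

Lemma vprod_mdivides (V : finType) (S : {set V}) (m : {cmonom V}) :
  mdivides (vprod S) m <-> S \subset [set x | 0 < m x]%N.
Proof.
rewrite mdividesP; split=> [le_Sm|/subsetP sSm x].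
  by apply/subsetP=> x xS; rewrite inE; have:= le_Sm x; rewrite vprodE xS.
by rewrite vprodE; case: (boolP (x \in S)) => // /sSm; rewrite inE.
Qed.

(** The support of a 1-cover is a vertex cover, so it contains a minimal one; exponents above 1 are
    irrelevant to covering. *)
Lemma minimal_cover_mdivides (V : finType) (G : graph V) (m : {cmonom V}) :
  is_cover G m ->
  exists2 S, minset (vertex_cover G) S & mdivides (vprod S) m.
Proof.
by move/is_coverE/minset_exists=> [S minS /vprod_mdivides]; exists S.
Qed.

(** A competing 1-cover [m] need not be squarefree a priori, but it is squeezed between [vprod T]
    and [vprod S] for a minimal cover [T] inside [S], and then [T = S]. *)
Lemma minimal_cover_vprod (V : finType) (G : graph V) (S : {set V}) :
  minimal_cover G (vprod S) <-> minset (vertex_cover G) S.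
Proof.
split=> [[/is_cover_vprod covS minS]|].
  apply/minsetP; split=> // T /is_cover_vprod covT sTS.
  rewrite -(vprod_supp T) (minS _ covT) ?vprod_supp //.
  by apply/vprod_mdivides; rewrite vprod_supp.
case/minsetP=> covS minS; split; first exact/is_cover_vprod.
move=> m /minimal_cover_mdivides[T /minsetp covT dvTm] dvmS.
have TS : T = S.
  apply: minS => //; rewrite -(vprod_supp S); apply/vprod_mdivides.
  exact: mdivides_trans dvmS.
apply/eqP/cmP=> x; apply/eqP; rewrite eqn_leq.
by move/mdividesP: dvmS => ->; rewrite -TS; move/mdividesP: dvTm => ->.
Qed.

(** * Cover ideals and their minimal generators *)

Lemma cover_idealP (k : fieldType) (V : finType) (G : graph V)
    (p : {malg k[{cmonom V}]}) :
  cover_ideal G p <-> forall m, m \in msupp p -> is_cover G m.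
Proof.
split=> [Ip m mp x y /Ip|covp x y xy].
  (* The edge ideal is displayed as generated by monomials, so that membership is tested on the
     support. *)
  rewrite -[X in ideal_gen X]/[seq << f >> | f <- [:: ucm x; ucm y]].
  case/monomial_ideal_genP/(_ m mp)=> f.
  by rewrite !inE => /orP[]/eqP ->; [left|right].
rewrite -[X in ideal_gen X]/[seq << f >> | f <- [:: ucm x; ucm y]].
apply/monomial_ideal_genP=> m /covp/(_ x y xy)[] dv.
  by exists (ucm x); rewrite // !inE eqxx.
by exists (ucm y); rewrite // !inE eqxx orbT.
Qed.

Lemma generator_is_cover (k : fieldType) (V : finType) (G : graph V)
    (fs : seq {cmonom V}) (f : {cmonom V}) :
  generated_by (@cover_ideal k V G) fs -> f \in fs -> is_cover G f.
Proof.
move=> gen ffs.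
have /gen/cover_idealP : ideal_gen [seq << g >> | g <- fs]
    (<< f >> : {malg k[{cmonom V}]}).
  by rewrite -[<< f >>]mul1r; apply/mem_ideal_gen/map_f.
by apply; rewrite msuppU1 in_fset1.
Qed.

(** The monomial [vprod S] lies in the ideal, so some generator divides it; that generator is itself
    a 1-cover, and minimality makes the two equal. *)
Lemma minimal_cover_generator (k : fieldType) (V : finType) (G : graph V)
    (fs : seq {cmonom V}) (S : {set V}) :
  generated_by (@cover_ideal k V G) fs ->
  minset (vertex_cover G) S -> vprod S \in fs.
Proof.
move=> gen /minimal_cover_vprod[covS minS].
have /gen/monomial_ideal_genP/(_ (vprod S)) : cover_ideal G
    (<< vprod S >> : {malg k[{cmonom V}]}).
  by apply/cover_idealP=> m; rewrite msuppU1 in_fset1 => /eqP ->.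
rewrite msuppU1 in_fset1 => /(_ (eqxx _))[f ffs dvf].
by rewrite -(minS f) //; apply: generator_is_cover gen ffs.
Qed.

Lemma vprod_inj (V : finType) : injective (@vprod V).
Proof. by move=> S T eqST; rewrite -(vprod_supp S) eqST vprod_supp. Qed.

Lemma cover_ideal_minimal_generators (k : fieldType) (V : finType)
    (G : graph V) :
  minimal_monomial_generators (@cover_ideal k V G)
    [seq vprod C | C <- enum (minset (vertex_cover G))].
Proof.
split; first by rewrite map_inj_uniq ?enum_uniq //; apply: vprod_inj.
  move=> p; rewrite cover_idealP monomial_ideal_genP.
  split=> cov m /cov.
    case/minimal_cover_mdivides=> S minS dvS; exists (vprod S) => //.
    by apply: map_f; rewrite mem_enum.
  case=> f /mapP[S]; rewrite mem_enum => /minsetp covS -> /vprod_mdivides sSm.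
  by apply/is_coverE; apply: vertex_coverS covS.
move=> gs _ gen x /mapP[S]; rewrite mem_enum => minS ->.
exact: minimal_cover_generator gen minS.
Qed.

(** This removes the algebra: what remains is a statement about weights of vertex sets. *)
Lemma quasi_equigeneratedP (k : fieldType) (V : finType) (G : graph V) :
  quasi_equigenerated (@cover_ideal k V G) <->
  exists2 alpha : V -> nat, (forall x, (0 < alpha x)%N) &
    forall S T, minset (vertex_cover G) S -> minset (vertex_cover G) T ->
      (\sum_(x in S) alpha x = \sum_(x in T) alpha x)%N.
Proof.
split=> [[fs [[_ gen _] [alpha [alpha_gt0 eq_deg]]]]|[alpha alpha_gt0 eq_deg]].
  exists alpha => // S T minS minT; rewrite -!wdeg_vprod.
  by apply: eq_deg; apply: minimal_cover_generator gen _.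
exists [seq vprod C | C <- enum (minset (vertex_cover G))].
split; first exact: cover_ideal_minimal_generators.
exists alpha; split=> // f g /mapP[S + ->] /mapP[T + ->].
by rewrite !mem_enum !wdeg_vprod; apply: eq_deg.
Qed.

(** * Minimal vertex covers of the join *)

Section Join.
Context (V1 V2 : finType).

Definition sumset (A : {set V1}) (B : {set V2}) : {set V1 + V2} :=
  [set u | match u with inl x => x \in A | inr y => y \in B end].

Lemma sumset_inl A B x : (inl x \in sumset A B) = (x \in A).
Proof. by rewrite inE. Qed.

Lemma sumset_inr A B y : (inr y \in sumset A B) = (y \in B).
Proof. by rewrite inE. Qed.

Lemma sumset_preim (C : {set V1 + V2}) : sumset (inl @^-1: C) (inr @^-1: C) = C.
Proof. by apply/setP=> -[x|y]; rewrite !inE. Qed.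

Lemma sumset_inj A B A' B' : sumset A B = sumset A' B' -> A = A' /\ B = B'.
Proof.
move=> eqS; split; apply/setP=> z.
  by rewrite -(sumset_inl A B) eqS sumset_inl.
by rewrite -(sumset_inr A B) eqS sumset_inr.
Qed.

Lemma sumset_subset A B A' B' :
  (sumset A B \subset sumset A' B') = (A \subset A') && (B \subset B').
Proof.
apply/subsetP/andP=> [sub|[/subsetP sA /subsetP sB] [x|y]].
- split; apply/subsetP=> z zin.
    by have:= sub (inl z); rewrite !sumset_inl; apply.
  by have:= sub (inr z); rewrite !sumset_inr; apply.
- by rewrite !sumset_inl; apply: sA.
- by rewrite !sumset_inr; apply: sB.
Qed.

Lemma big_sumset (w : V1 + V2 -> nat) A B :
  (\sum_(u in sumset A B) w u =
   \sum_(x in A) w (inl x) + \sum_(y in B) w (inr y))%N.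
Proof.
by rewrite big_sumType; congr (_ + _)%N; apply: eq_bigl => z; rewrite inE.
Qed.

Context (G1 : graph V1) (G2 : graph V2) (U1 : {set V1}) (U2 : {set V2}).

Let G := graph_join G1 G2 U1 U2.

(** The added edges form a complete bipartite graph between [U1] and [U2]: if a vertex of [U1] is
    missed, all of [U2] must be taken. *)
Lemma vertex_cover_join A B :
  vertex_cover G (sumset A B) =
  [&& vertex_cover G1 A, vertex_cover G2 B & (U1 \subset A) || (U2 \subset B)].
Proof.
apply/vertex_coverP/and3P=> [cov|[/vertex_coverP covA /vertex_coverP covB sub]].
  split.
  - apply/vertex_coverP=> x y xy.
    by have:= cov (inl x) (inl y) xy; rewrite !inE.
  - apply/vertex_coverP=> x y xy.
    by have:= cov (inr x) (inr y) xy; rewrite !inE.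
  - case: (boolP (U1 \subset A)) => //= /subsetPn[x xU1 xA].
    apply/subsetP=> y yU2; have:= cov (inl x) (inr y).
    by rewrite /= xU1 yU2 !inE (negbTE xA); apply.
case=> [x|x] [y|y] /=; rewrite !inE; try by [exact: covA | exact: covB].
  by case/andP=> xU1 yU2; case/orP: sub => /subsetP ->; rewrite ?orbT.
by case/andP=> yU1 xU2; case/orP: sub => /subsetP ->; rewrite ?orbT.
Qed.

Hypotheses (cov1 : vertex_cover G1 U1) (cov2 : vertex_cover G2 U2).

(** If [U1] lies in [A], then [U1] with any cover of [G2] inside [B] is already a cover of the join;
    minimality gives both [A = U1] and the minimality of [B]. The other case is symmetric. *)
Lemma minset_join_sub A B :
  minset (vertex_cover G) (sumset A B) ->
  (A = U1 /\ minset (vertex_cover G2) B) \/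
  (B = U2 /\ minset (vertex_cover G1) A).
Proof.
case/minsetP; rewrite vertex_cover_join => /and3P[covA covB /orP[sU|sU]] minAB.
  left; have [|<- _] := @sumset_inj U1 B A B.
    apply: minAB; last by rewrite sumset_subset sU subxx.
    by rewrite vertex_cover_join cov1 covB subxx.
  split=> //; apply/minsetP; split=> // C covC sCB.
  have [|//] := @sumset_inj U1 C A B.
  apply: minAB; last by rewrite sumset_subset sU sCB.
  by rewrite vertex_cover_join cov1 covC subxx.
right; have [|_ <-] := @sumset_inj A U2 A B.
  apply: minAB; last by rewrite sumset_subset sU subxx.
  by rewrite vertex_cover_join cov2 covA subxx orbT.
split=> //; apply/minsetP; split=> // C covC sCA.
have [|//] := @sumset_inj C U2 A B.
apply: minAB; last by rewrite sumset_subset sU sCA.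
by rewrite vertex_cover_join cov2 covC subxx orbT.
Qed.

Hypothesis minU : minset (vertex_cover G1) U1 = minset (vertex_cover G2) U2.

Lemma minset_join_left B :
  minset (vertex_cover G2) B -> minset (vertex_cover G) (sumset U1 B).
Proof.
move=> minB; have [covB _] := minsetP minB; apply/minsetP.
rewrite vertex_cover_join cov1 covB subxx; split=> // C.
rewrite -(sumset_preim C) vertex_cover_join sumset_subset.
move=> /and3P[covC1 covC2 sub] /andP[sC1 sC2].
have CB := minsetinf minB covC2 sC2; rewrite CB in sub *.
case/orP: sub => sub; first by congr sumset; apply/eqP; rewrite eqEsubset sC1.
(* Here [U2] lies in [B], so [B = U2] is minimal; by [minU] so is [U1], and the part of [C] in [V1],
   a cover inside [U1], is all of [U1]. *)
have UB := minsetinf minB cov2 sub.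
by move: minB; rewrite -UB -minU => minU1; rewrite (minsetinf minU1 covC1).
Qed.

Lemma minset_join_right A :
  minset (vertex_cover G1) A -> minset (vertex_cover G) (sumset A U2).
Proof.
move=> minA; have [covA _] := minsetP minA; apply/minsetP.
rewrite vertex_cover_join cov2 covA subxx orbT; split=> // C.
rewrite -(sumset_preim C) vertex_cover_join sumset_subset.
move=> /and3P[covC1 covC2 sub] /andP[sC1 sC2].
have CA := minsetinf minA covC1 sC1; rewrite CA in sub *.
case/orP: sub => sub; last by congr sumset; apply/eqP; rewrite eqEsubset sC2.
have UA := minsetinf minA cov1 sub.
by move: minA; rewrite -UA minU => minU2; rewrite (minsetinf minU2 covC2).
Qed.

End Join.

(** * Balancing the weights *)

(** A minimal set inside [U] omits some element of [U], whose weight is positive. *)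
Lemma minset_sum_ltn (V : finType) (P : pred {set V}) (alpha : V -> nat)
    (U : {set V}) :
  (forall x, (0 < alpha x)%N) -> P U -> ~~ minset P U ->
  exists2 S, minset P S & (\sum_(x in S) alpha x < \sum_(x in U) alpha x)%N.
Proof.
move=> alpha_gt0 PU nminU; have [S minS sSU] := minset_exists PU.
exists S => //.
rewrite [ltnRHS](big_setID S) /= (setIidPr sSU) -[ltnLHS]addn0 ltn_add2l.
have /set0Pn[x xUS] : U :\: S != set0.
  rewrite setD_eq0; apply: contra nminU => sUS.
  by rewrite (_ : U = S) //; apply/eqP; rewrite eqEsubset sUS.
by rewrite (bigD1 x xUS) /= ltn_addr.
Qed.

Lemma balancing_multipliers (V1 V2 : finType) (P1 : pred {set V1})
    (P2 : pred {set V2}) (U1 : {set V1}) (U2 : {set V2})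
    (w1 : V1 -> nat) (w2 : V2 -> nat) :
  P1 U1 -> P2 U2 -> minset P1 U1 = minset P2 U2 ->
  (forall x, (0 < w1 x)%N) -> (forall y, (0 < w2 y)%N) ->
  (forall A A', minset P1 A -> minset P1 A' ->
     (\sum_(x in A) w1 x = \sum_(x in A') w1 x)%N) ->
  (forall B B', minset P2 B -> minset P2 B' ->
     (\sum_(y in B) w2 y = \sum_(y in B') w2 y)%N) ->
  exists c1 c2, [/\ (0 < c1)%N, (0 < c2)%N &
    forall A B, minset P1 A -> minset P2 B ->
    (c1 * \sum_(x in U1) w1 x + c2 * \sum_(y in B) w2 y =
     c1 * \sum_(x in A) w1 x + c2 * \sum_(y in U2) w2 y)%N].
Proof.
move=> PU1 PU2 minU w1_gt0 w2_gt0 eq1 eq2.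
case: (boolP (minset P1 U1)) => [minU1|nminU1].
  (* Both excesses vanish, so no rescaling is required. *)
  exists 1%N, 1%N; split=> // A B minA minB.
  by rewrite (eq1 _ A) // (eq2 _ U2) // -minU.
have nminU2 : ~~ minset P2 U2 by rewrite -minU.
have [A0 minA0 lt1] := minset_sum_ltn w1_gt0 PU1 nminU1.
have [B0 minB0 lt2] := minset_sum_ltn w2_gt0 PU2 nminU2.
(* The multipliers are the excesses crosswise: [c1 = e2] and [c2 = e1], positive by [lt2] and
   [lt1]. *)
exists (\sum_(y in U2) w2 y - \sum_(y in B0) w2 y)%N.
exists (\sum_(x in U1) w1 x - \sum_(x in A0) w1 x)%N.
split=> [||A B minA minB]; rewrite ?subn_gt0 //.
rewrite (eq1 _ _ minA minA0) (eq2 _ _ minB minB0).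
(* Only the bare weights of [U1] and [U2] are expanded, as [e1 + d1] and [e2 + d2]; the truncated
   differences stay as atoms for [ring]. Both sides become [e1 * e2 + e2 * d1 + e1 * d2]. *)
move/ltnW/subnK: lt1 => {1}<-; move/ltnW/subnK: lt2 => {3}<-; ring.
Qed.

Theorem theorem3p16 (k : fieldType) (V1 V2 : finType)
    (G1 : graph V1) (G2 : graph V2) (U1 : {set V1}) (U2 : {set V2})
    (U1_neq0 : U1 <> set0) (U2_neq0 : U2 <> set0)
    (linked : linked_with_covers G1 G2 U1 U2)
    (both : (minimal_cover G1 (vprod U1) /\ minimal_cover G2 (vprod U2)) \/
            (~ minimal_cover G1 (vprod U1) /\ ~ minimal_cover G2 (vprod U2))) :
  quasi_equigenerated (@cover_ideal k _ (graph_join G1 G2 U1 U2)) <->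
  (quasi_equigenerated (@cover_ideal k _ G1) /\
   quasi_equigenerated (@cover_ideal k _ G2)).
Proof.
case: linked => /is_cover_vprod cov1 /is_cover_vprod cov2.
(* The two alternatives of [both] merge into one boolean equality. *)
have minU : minset (vertex_cover G1) U1 = minset (vertex_cover G2) U2.
  rewrite !minimal_cover_vprod in both.
  by case: both => -[m1 m2]; [rewrite m1 m2 | apply/idP/idP].
rewrite !quasi_equigeneratedP; split=> [[w w_gt0 eqw]|[[w1 w1_gt0 eq1]]].
  split.
    (* The covers [A + U2] and [A' + U2] have equal weight, and the common contribution of [U2]
       cancels. *)
    exists (fun x => w (inl x)) => // A A' minA minA'.
    have := eqw _ _ (minset_join_right cov1 cov2 minU minA)
                    (minset_join_right cov1 cov2 minU minA').
    by rewrite !big_sumset => /addIn.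
  exists (fun y => w (inr y)) => // B B' minB minB'.
  have := eqw _ _ (minset_join_left cov1 cov2 minU minB)
                  (minset_join_left cov1 cov2 minU minB').
  by rewrite !big_sumset => /addnI.
case=> w2 w2_gt0 eq2.
have [c1 [c2 [c1_gt0 c2_gt0 balanced]]] :=
  balancing_multipliers cov1 cov2 minU w1_gt0 w2_gt0 eq1 eq2.
exists (fun u => match u with inl x => c1 * w1 x | inr y => c2 * w2 y end)%N.
  by case=> z; rewrite muln_gt0 ?c1_gt0 ?c2_gt0 /=.
have [B0 minB0 _] := minset_exists cov2.
(* The weight of [U1 + B0] serves as the common value: covers [U1 + B] match it by [eq2], covers
   [A + U2] by [balanced]. *)
suff main C : minset (vertex_cover (graph_join G1 G2 U1 U2)) C ->
  (\sum_(u in C) match u with inl x => c1 * w1 x | inr y => c2 * w2 y end =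
   c1 * \sum_(x in U1) w1 x + c2 * \sum_(y in B0) w2 y)%N.
  by move=> S T /main -> /main ->.
rewrite -(sumset_preim C) big_sumset -!big_distrr /=.
case/(minset_join_sub cov1 cov2) => -[-> minD]; first by rewrite (eq2 _ B0).
by rewrite (balanced _ B0 minD).
Qed.
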